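(* Fix $E>0$ and $q_a<q_b$. For $\varepsilon>0$ let $q_\varepsilon\colon\mathbb{R}\to\mathbb{R}$ satisfy $$q_\varepsilon''(t)=-\frac1\varepsilon V'\!\left(\frac{q_\varepsilon(t)}{\varepsilon}\right),\quad t\in\mathbb{R},$$ with $q_\varepsilon'>0$, $q_\varepsilon(0)=q_a$, $q_\varepsilon(T_\varepsilon)=q_b$ and $$\frac12|q_\varepsilon'(t)|^2+V(q_\varepsilon(t)/\varepsilon)=E,\quad t\in\mathbb{R}.$$ Then $q_\varepsilon$ converges uniformly (on $\mathbb{R}$) as $\varepsilon\to0$ to $q(t)=\frac{t}{\sigma(E)}+q_a$. Furthermore $q(\bar T)=q_b$, where $\bar T=\sigma(E)(q_b-q_a)$.
   Context: $V\in C^2(\mathbb{R})$ is $1$-periodic with $\max V=0$. For $E>0$, $$\sigma(E):=\int_0^1\frac{1}{\sqrt{2(E-V(\gamma))}}\,d\gamma.$$ The arrival time $T_\varepsilon$ is allowed to depend on $\varepsilon$. *)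

(* Defs.v *)
From Stdlib Require Import Reals.
From Coquelicot Require Import Coquelicot.
Open Scope R_scope.

(* All orders k <= 2 are required: [ex_derive_n f 2 x] alone speaks about the
   total function [Derive f] and does not entail that [f] is differentiable. *)
Definition C2 (f : R -> R) : Prop :=
  forall k : nat, (k <= 2)%nat ->
  forall x : R, ex_derive_n f k x /\ continuous (Derive_n f k) x.

Definition periodic1 (f : R -> R) : Prop := forall x : R, f (x + 1) = f x.

Definition has_max (f : R -> R) (m : R) : Prop :=
  (exists x : R, f x = m) /\ (forall x : R, f x <= m).

Definition sigma_V (V : R -> R) (E : R) : R :=
  RInt (fun g => 1 / sqrt (2 * (E - V g))) 0 1.

(* Differentiability of [q] is separate from the equation, since [is_derive_n]
   at order 2 only constrains the total function [Derive q]. *)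
Definition solves_newton (V : R -> R) (eps : R) (q : R -> R) : Prop :=
  (forall t : R, ex_derive q t) /\
  (forall t : R, is_derive_n q 2 t (- (1 / eps) * Derive V (q t / eps))).

(* [ball q0 eta f] in [fct_UniformSpace] is [forall t, Rabs (f t - q0 t) < eta],
   so this is uniform convergence on all of R as the parameter tends to 0+. *)
Definition converges_uniformly (q : R -> R -> R) (q0 : R -> R) : Prop :=
  filterlim q (at_right 0) (@locally (fct_UniformSpace R R_UniformSpace) q0).

(* Main.v *)
Require Import Defs.
From Stdlib Require Import Reals ZArith Lra Lia.
From Coquelicot Require Import Coquelicot.
Open Scope R_scope.

(** Write [f g = 1 / sqrt (2 (E - V g))], a continuous positive 1-periodic
    function, [F x] for its integral over [[0, x]], and [sigma = F 1].  Energy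
    conservation together with [q' > 0] says [q' * f (q / eps) = 1], that is,
    [eps * F (q / eps)] has derivative 1 in time, so
      [eps * (F (q t / eps) - F (qa / eps)) = t].
    On the other hand [F x - sigma * x] is 1-periodic, because [f] is, and on
    one period it lies between [- sigma] and [sigma], because [F] is
    nondecreasing.  Hence [|t - sigma * (q t - qa)| <= 2 * eps * sigma] for all
    [t], and dividing by [sigma] gives the explicit uniform rate
      [|q t - (t / sigma + qa)| <= 2 * eps]
    ([slow_fast_estimate] below). *)

Lemma derive_zero_constant (f : R -> R) :
  (forall x, is_derive f x 0) -> forall a b, f a = f b.
Proof.
  intros Hf a b.
  destruct (MVT_gen f a b (fun _ => 0)) as [c [_ Hc]].
  - intros x _; apply Hf.
  - intros x _. apply continuity_pt_filterlim.
    apply (ex_derive_continuous f). exists 0; apply Hf.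
  - lra.
Qed.

Section PeriodicIntegral.

Variable f : R -> R.
Hypothesis f_cont : forall x, continuous f x.
Hypothesis f_per : forall x, f (x + 1) = f x.
Hypothesis f_pos : forall x, 0 < f x.

Lemma primitive_derive x : is_derive (fun y => RInt f 0 y) x (f x).
Proof.
  apply (is_derive_RInt f _ 0); [|apply f_cont].
  apply filter_forall; intros y. apply (@RInt_correct R_CompleteNormedModule).
  apply (@ex_RInt_continuous R_CompleteNormedModule); intros; apply f_cont.
Qed.

(** The deviation of the primitive from the linear function of the same mean
    slope. *)
Let H (x : R) := RInt f 0 x - RInt f 0 1 * x.

Lemma primitive_defect_periodic x : H (x + 1) = H x.
Proof.
  assert (HD : forall y, is_derive (fun z => H (z + 1) - H z) y 0).
  { intros y. unfold H.
    evar_last.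
    - apply (@is_derive_minus R_AbsRing R_NormedModule).
      + apply (@is_derive_minus R_AbsRing R_NormedModule).
        * apply (is_derive_comp (fun y => RInt f 0 y) (fun z => z + 1)).
          -- apply primitive_derive.
          -- apply (is_derive_plus (fun z => z) (fun _ => 1));
               [apply is_derive_id | apply is_derive_const].
        * apply (is_derive_scal (fun z => z + 1)).
          apply (is_derive_plus (fun z => z) (fun _ => 1));
               [apply is_derive_id | apply is_derive_const].
      + apply (@is_derive_minus R_AbsRing R_NormedModule).
        * apply primitive_derive.
        * apply (is_derive_scal (fun z => z)). apply is_derive_id.
    - rewrite f_per.
      unfold minus, plus, opp, scal, one, zero; simpl; unfold mult; simpl.
      ring. }
  assert (H01 : H (0 + 1) - H 0 = 0).
  { unfold H. rewrite Rplus_0_l, RInt_point. unfold zero; simpl. ring. }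
  pose proof (derive_zero_constant _ HD x 0) as Hx; simpl in Hx. lra.
Qed.

Lemma primitive_nondecreasing x y :
  x <= y -> RInt f 0 x <= RInt f 0 y.
Proof.
  intros Hxy.
  destruct (MVT_gen (fun y => RInt f 0 y) x y f) as [c [_ Hc]].
  - intros z _; apply primitive_derive.
  - intros z _. apply continuity_pt_filterlim.
    apply (ex_derive_continuous (fun y => RInt f 0 y)).
    eexists; apply primitive_derive.
  - pose proof (f_pos c). nra.
Qed.

Lemma period_integral_pos : 0 < RInt f 0 1.
Proof.
  apply RInt_gt_0; [lra | intros; apply f_pos | intros; apply f_cont].
Qed.

Lemma primitive_defect_bounded x : Rabs (H x) <= RInt f 0 1.
Proof.
  assert (Hn : forall (n : nat) y, H (y + INR n) = H y).
  { induction n as [|n IH]; intros y.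
    - simpl; f_equal; ring.
    - rewrite S_INR, <- Rplus_assoc, primitive_defect_periodic; apply IH. }
  assert (Hz : forall (z : Z) y, H (y + IZR z) = H y).
  { intros z y. destruct (Z_le_gt_dec 0 z) as [Hz|Hz].
    - rewrite <- (Z2Nat.id z Hz), <- INR_IZR_INZ. apply Hn.
    - rewrite <- (Hn (Z.to_nat (- z)) (y + IZR z)). f_equal.
      rewrite INR_IZR_INZ, Z2Nat.id, opp_IZR by lia. ring. }
  assert (Hunit : forall y, 0 <= y <= 1 -> Rabs (H y) <= RInt f 0 1).
  { intros y Hy.
    pose proof (primitive_nondecreasing 0 y (proj1 Hy)) as H1.
    pose proof (primitive_nondecreasing y 1 (proj2 Hy)) as H2.
    pose proof period_integral_pos.
    rewrite RInt_point in H1. change (@zero R_CompleteNormedModule) with 0 in H1.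
    unfold H. apply Rabs_le. nra. }
  destruct (base_fp x) as [Hf0 Hf1].
  replace x with (frac_part x + IZR (Int_part x)) by (unfold frac_part; ring).
  rewrite Hz. apply Hunit. lra.
Qed.

(** A trajectory following the slowness field [f (q / eps)], that is, spending
    time [f (q / eps)] per unit length, moves at the effective speed
    [1 / sigma] up to an error of two microscopic periods. *)
Lemma slow_fast_estimate (eps : R) (q dq : R -> R) :
  0 < eps ->
  (forall t, is_derive q t (dq t)) ->
  (forall t, dq t * f (q t / eps) = 1) ->
  forall t, Rabs (q t - (t / RInt f 0 1 + q 0)) <= 2 * eps.
Proof.
  intros Heps Hq Hdq t.
  set (s := RInt f 0 1).
  assert (Hs : 0 < s) by apply period_integral_pos.
  assert (HD : forall u, is_derive (fun u => eps * RInt f 0 (q u / eps) - u) u 0).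
  { intros u. evar_last.
    - apply (@is_derive_minus R_AbsRing R_NormedModule).
      + apply (is_derive_scal (fun u => RInt f 0 (q u / eps))).
        apply (is_derive_comp (fun y => RInt f 0 y) (fun u => q u / eps)).
        * apply primitive_derive.
        * apply (is_derive_ext (fun u => / eps * q u)).
          { intros v; apply Rmult_comm. }
          apply is_derive_scal, Hq.
      + apply is_derive_id.
    - unfold minus, plus, opp, scal, one; simpl; unfold mult; simpl.
      transitivity (dq u * f (q u / eps) - 1); [field; lra |].
      rewrite Hdq; ring. }
  pose proof (derive_zero_constant _ HD t 0) as Ht; simpl in Ht.
  pose proof (primitive_defect_bounded (q t / eps)) as Bt.
  pose proof (primitive_defect_bounded (q 0 / eps)) as B0.
  unfold H in Bt, B0; fold s in Bt, B0.
  apply Rabs_le_between in Bt; apply Rabs_le_between in B0.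
  set (Ft := RInt f 0 (q t / eps)) in *.
  set (F0 := RInt f 0 (q 0 / eps)) in *.
  assert (Herr : q t - (t / s + q 0)
     = eps / s * ((F0 - s * (q 0 / eps)) - (Ft - s * (q t / eps)))).
  { replace t with (eps * (Ft - F0)) at 2 by lra. field. split; lra. }
  assert (He : 0 < eps / s) by (apply Rdiv_lt_0_compat; lra).
  replace (2 * eps) with (eps / s * (2 * s)) by (field; lra).
  rewrite Herr, Rabs_mult, (Rabs_pos_eq (eps / s)) by lra.
  apply Rmult_le_compat_l; [lra|]. apply Rabs_le. lra.
Qed.

End PeriodicIntegral.

Theorem corollary2p6 (V : R -> R) (hV : C2 V) (hper : periodic1 V)
  (hmax : has_max V 0) (E : R) (hE : 0 < E) (qa qb : R) (hab : qa < qb)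
  (q : R -> R -> R) (T : R -> R)
  (hsol : forall eps : R, 0 < eps -> solves_newton V eps (q eps))
  (hpos : forall eps : R, 0 < eps -> forall t : R, 0 < Derive (q eps) t)
  (hstart : forall eps : R, 0 < eps -> q eps 0 = qa)
  (hend : forall eps : R, 0 < eps -> q eps (T eps) = qb)
  (henergy : forall eps : R, 0 < eps -> forall t : R,
     1 / 2 * Rabs (Derive (q eps) t) ^ 2 + V (q eps t / eps) = E) :
  let qlim := fun t : R => t / sigma_V V E + qa in
  let Tbar := sigma_V V E * (qb - qa) in
  converges_uniformly q qlim /\ qlim Tbar = qb.
Proof.
  intros qlim Tbar.
  set (f := fun g => 1 / sqrt (2 * (E - V g))).
  assert (Harg : forall x, 0 < 2 * (E - V x)).
  { intros x. pose proof (proj2 hmax x). lra. }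
  assert (Hsqrt : forall x, 0 < sqrt (2 * (E - V x))).
  { intros x. apply sqrt_lt_R0, Harg. }
  assert (f_pos : forall x, 0 < f x).
  { intros x. apply Rdiv_lt_0_compat; [lra | apply Hsqrt]. }
  assert (f_per : forall x, f (x + 1) = f x).
  { intros x. unfold f. rewrite hper. reflexivity. }
  assert (f_cont : forall x, continuous f x).
  { intros x. apply continuity_pt_filterlim.
    assert (HVc : continuity_pt V x).
    { apply continuity_pt_filterlim. apply (proj2 (hV 0%nat (Nat.le_0_l 2) x)). }
    apply (continuity_pt_div (fun _ => 1) (fun g => sqrt (2 * (E - V g)))).
    - apply continuity_pt_const; intros ? ?; reflexivity.
    - apply (continuity_pt_comp (fun g => 2 * (E - V g)) sqrt).
      + apply (continuity_pt_mult (fun _ => 2) (fun g => E - V g)).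
        * apply continuity_pt_const; intros ? ?; reflexivity.
        * apply (continuity_pt_minus (fun _ => E) V); [|exact HVc].
          apply continuity_pt_const; intros ? ?; reflexivity.
      + apply continuity_pt_sqrt. left; apply Harg.
    - apply Rgt_not_eq, Hsqrt. }
  assert (Hs : 0 < sigma_V V E) by exact (period_integral_pos f f_cont f_pos).
  split.
  - apply filterlim_locally. intros eta.
    assert (Hd : 0 < eta / 2) by (pose proof (cond_pos eta); lra).
    exists (mkposreal _ Hd). intros eps Hball Heps t.
    apply Rabs_lt_between' in Hball; simpl in Hball.
    change (Rabs (q eps t - qlim t) < eta).
    apply Rle_lt_trans with (2 * eps); [|lra].
    unfold qlim. rewrite <- (hstart eps Heps).
    apply (slow_fast_estimate f f_cont f_per f_pos eps (q eps) (Derive (q eps)) Heps).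
    + intros u. apply Derive_correct, (proj1 (hsol eps Heps)).
    + intros u. unfold f.
      (* The energy relation and the sign of [q'] determine the velocity. *)
      replace (2 * (E - V (q eps u / eps))) with (Derive (q eps) u ^ 2).
      2: { rewrite <- (henergy eps Heps u), pow2_abs. field. }
      pose proof (hpos eps Heps u).
      rewrite sqrt_pow2 by lra. field. lra.
  - unfold qlim, Tbar. field. lra.
Qed.
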